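(* Let $n\in\mathbb{N}$, let $I_1=\Omega_1=\{1,\dots,n\}$, and let $\mu_1$ be the probability measure on $\Omega_1$ with $\mu_1(\{i\})=\frac1n$ for all $1\le i\le n$. Let $G_1$ be a collection of maps from $I_1$ to $\Omega_1$ and let $\mathbb{P}_1$ be a probability measure on $G_1$. If for some constant $C_{G_1}\ge1$, for all $i\in I_1$, all different indices $i_1,i_2\in I_1$ and all sets $A,A_1,A_2\subset\Omega_1$, (i) $\mathbb{P}_1(g(i)\in A)=\mu_1(A)$, (ii) $\mathbb{P}_1(g(i_1)\in A_1,\ g(i_2)\in A_2)\le C_{G_1}\mu_1(A_1)\mu_1(A_2)$, then $G_1$ consists of at least $\frac{n^2}{C_{G_1}}$ elements. *)

(* Defs.v *)
From HB Require Import structures.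
From mathcomp Require Import all_boot all_order all_algebra.
From mathcomp Require Import all_classical all_reals all_analysis.
Set Implicit Arguments.
Unset Strict Implicit.
Unset Printing Implicit Defensive.

HB.instance Definition _ (n : nat) := isPointed.Build 'I_n.+1 ord0.

HB.instance Definition _ (n : nat) := @isMeasurable.Build
  default_measure_display 'I_n.+1 discrete_measurable
  discrete_measurable0 discrete_measurableC discrete_measurableU.

(* A measurableType must be pointed, hence the nonemptiness argument, which a
   set carrying a probability measure satisfies anyway. *)
Definition elements_of (T : finType) (G : {set T}) (_ : 0 < #|G|) :=
  {g : T | g \in G}.

Section ElementsOf.
Variables (T : finType) (G : {set T}) (G_gt0 : 0 < #|G|).

HB.instance Definition _ := Finite.on (elements_of G_gt0).

HB.instance Definition _ := isPointed.Build (elements_of G_gt0)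
  (exist (fun g => g \in G) _ (xchooseP (elimT card_gt0P G_gt0))).

HB.instance Definition _ := @isMeasurable.Build
  default_measure_display (elements_of G_gt0) discrete_measurable
  discrete_measurable0 discrete_measurableC discrete_measurableU.

End ElementsOf.

(* Main.v *)
Require Import Defs.
From mathcomp Require Import all_boot all_order all_algebra.
From mathcomp Require Import all_classical all_reals all_analysis.
Import Order.TTheory GRing.Theory Num.Theory.
Local Open Scope classical_set_scope.
Local Open Scope ring_scope.

(** Distinct indices [i1, i2] exist once there are at least two; (ii) applied
    to the singletons [A1 = {g i1}] and [A2 = {g i2}] then bounds the mass of
    every single [g] by [C / n^2], and these masses add up to 1. *)

(** The singletons cover the space, so by finite subadditivity [1 = P setT] is at most a sum of
    [#|G|] atoms. *)
Lemma probability_atoms_le_card (R : realType) (T : finType) (G : {set T})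
    (G_gt0 : (0 < #|G|)%N) (P : probability (elements_of G_gt0) R) (c : R) :
  (forall g : elements_of G_gt0, (P [set g] <= c%:E)%E) -> 1 <= #|G|%:R * c.
Proof.
move=> Pc; rewrite mulr_natl.
have finT : finite_set [set: elements_of G_gt0] by exact: finite_finset.
have : (P setT <= \sum_(g \in [set: elements_of G_gt0]) P [set g])%E.
  by apply: content_sub_fsum => // g _; exists g.
rewrite (fsbigE (index_enum (elements_of G_gt0))) ?index_enum_uniq //=; last first.
  by move=> g _; rewrite mem_index_enum.
rewrite (eq_bigl xpredT) => [|g]; last exact: in_setT.
rewrite probability_setT => /le_trans le_sumP.
(* Counting [G] through its subtype turns [c *+ #|G|] into a constant sum over the same index type,
   so the sums compare termwise. *)
rewrite -lee_fin -[#|G|]card_sig -sumr_const -sumEFin.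
by apply: le_sumP; apply: lee_sum.
Qed.

Theorem mainTheorem6 (R : realType) (n : nat)
    (mu : probability 'I_n.+1 R)
    (hmu : forall i : 'I_n.+1, mu [set i] = (1 / n.+1%:R)%:E)
    (G : {set {ffun 'I_n.+1 -> 'I_n.+1}}) (G_gt0 : (0 < #|G|)%N)
    (P : probability (elements_of G_gt0) R)
    (C : R) (hC : 1 <= C)
    (hi : forall (i : 'I_n.+1) (A : set 'I_n.+1),
      P [set g : elements_of G_gt0 | A (sval g i)] = mu A)
    (hii : forall (i1 i2 : 'I_n.+1) (A1 A2 : set 'I_n.+1), i1 != i2 ->
      (P [set g : elements_of G_gt0 | A1 (sval g i1) /\ A2 (sval g i2)]
       <= C%:E * mu A1 * mu A2)%E) :
  n.+1%:R ^+ 2 / C <= #|G|%:R.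
Proof.
have C_gt0 : 0 < C by exact: lt_le_trans hC.
case: n => [|n] in mu hmu G G_gt0 P hi hii *.
  (* A single point has no two distinct indices; here the bound is just [C^-1 <= 1 <= #|G|]. *)
  rewrite expr1n div1r (le_trans (y := 1)) ?invf_le1 //.
  by rewrite ler1n.
have Patom (g : elements_of G_gt0) : (P [set g] <= (C / n.+2%:R ^+ 2)%:E)%E.
  (* In ['I_n.+2] the first and last indices differ by computation. The event contains [g], so
     monotonicity bounds its atom. *)
  have := hii ord0 ord_max [set sval g ord0] [set sval g ord_max] isT.
  rewrite !hmu -!EFinM !div1r -mulrA -invfM -expr2; apply: le_trans.
  by apply: le_measure; rewrite ?inE // => h /= ->.
have := probability_atoms_le_card _ _ _ _ _ _ Patom.
by rewrite mulrA ler_pdivlMr ?mul1r ?exprn_gt0 // ler_pdivrMr.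
Qed.
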